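(* Let $f:\mathbb{R}^n\to\mathbb{R}$ and $c:\mathbb{R}^n\to\mathbb{R}^m$ be continuously differentiable with locally Lipschitz continuous derivatives, let $g:\mathbb{R}^n\to\mathbb{R}\cup\{\infty\}$ be proper, lower semicontinuous and prox-bounded, let $D\subset\mathbb{R}^m$ be nonempty and closed, and put $q:=f+g$. Consider a sequence $\{(x^k,s^k)\}_{k\in\mathbb{N}}$ of iterates generated by the augmented Lagrangian method (described in the context) with tolerances satisfying $\varepsilon_k\to 0$. Let $(x^*,c(x^* ))$ be an accumulation point of $\{(x^k,s^k)\}$ that is feasible for the problem of minimizing $q(x)$ over $(x,s)\in\mathbb{R}^n\times\mathbb{R}^m$ subject to $c(x)-s=0$, $s\in D$ (that is, $x^*\in\operatorname{dom} q$ and $c(x^* )\in D$), and let $\{(x^k,s^k)\}_{k\in K}$ be a subsequence such that, as $k\to\infty$ in $K$, $x^k\to x^*$ with $q(x^k)\to q(x^* )$, and $s^k\to c(x^* )$. Then $x^*$ is an asymptotically M-stationary (AM-stationary) point of the problem of minimizing $q(x)$ subject to $c(x)\in D$.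
   Context: **Basic notions.** For $h:\mathbb{R}^N\to\mathbb{R}\cup\{\infty\}$, $\operatorname{dom}h=\{x: h(x)<\infty\}$; $h$ is proper if $\operatorname{dom}h\neq\emptyset$, and prox-bounded if it is proper and $h+\|\cdot\|^2/(2\gamma)$ is bounded below for some $\gamma>0$. For $h$ proper and lower semicontinuous and $\bar x\in\operatorname{dom}h$, the regular subdifferential is $\hat\partial h(\bar x)=\{v:\liminf_{x\to\bar x,\,x\ne\bar x}\frac{h(x)-h(\bar x)-\langle v,x-\bar x\rangle}{\|x-\bar x\|}\ge 0\}$, and the (limiting) subdifferential $\partial h(\bar x)$ is the set of $v$ for which there are $x^j\to\bar x$ with $h(x^j)\to h(\bar x)$ and $v^j\in\hat\partial h(x^j)$ with $v^j\to v$; both are empty if $\bar x\notin\operatorname{dom}h$. For closed nonempty $D\subset\mathbb{R}^m$ with projection $\Pi_D(v)=\operatorname{argmin}_{z\in D}\|z-v\|$, the limiting normal cone at $z\in D$ is $\mathcal N_D^{\lim}(z)=\limsup_{v\to z}\operatorname{cone}(v-\Pi_D(v))$ (outer limit: all limits of $w^j\in\operatorname{cone}(v^j-\Pi_D(v^j))$ with $v^j\to z$), and $\mathcal N_D^{\lim}(z)=\emptyset$ for $z\notin D$. $\nabla c(x)\in\mathbb{R}^{m\times n}$ denotes the Jacobian. **AM-stationarity.** A point $x^*$ with $x^*\in\operatorname{dom}q$, $c(x^* )\in D$ is asymptotically M-stationary (AM-stationary) for ''minimize $q(x)$ subject to $c(x)\in D$'' if there are sequences $\{x^k\},\{\eta^k\}\subset\mathbb{R}^n$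 and $\{y^k\},\{\zeta^k\}\subset\mathbb{R}^m$ such that $x^k\to x^*$, $q(x^k)\to q(x^* )$, $\eta^k\to0$, $\zeta^k\to0$ and, for all $k\in\mathbb{N}$, $-\nabla c(x^k)^\top y^k+\eta^k\in\partial q(x^k)$ and $y^k\in\mathcal N_D^{\lim}(c(x^k)+\zeta^k)$. **Augmented Lagrangian.** For $\mu>0$, with $\delta_D$ the indicator function of $D$ ($0$ on $D$, $\infty$ elsewhere), $\mathcal L^S_\mu(x,s,y)=q(x)+\delta_D(s)+\langle y,c(x)-s\rangle+\frac1{2\mu}\|c(x)-s\|^2$. For $\varepsilon\ge0$, $(x,s)$ is an $\varepsilon$-stationary point of $\mathcal L^S_\mu(\cdot,\cdot,y)$ if there is $\eta$ in the limiting subdifferential of the function $\mathcal L^S_\mu(\cdot,\cdot,y)$ at $(x,s)$ with $\|\eta\|\le\varepsilon$. **Augmented Lagrangian method.** Fix $\mu_0>0$, $\theta,\kappa\in(0,1)$ and a nonempty bounded set $Y\subset\mathbb{R}^m$. For $k=0,1,2,\dots$: (1) select $\hat y^k\in Y$ and $\varepsilon_k\ge0$; (2) compute an $\varepsilon_k$-stationary point $(x^k,s^k)\in\mathbb{R}^n\times D$ of $\mathcal L^S_{\mu_k}(\cdot,\cdot,\hat y^k)$; (3) set $y^k=\hat y^k+[c(x^k)-s^k]/\mu_k$; (4) if $k=0$ or $\|c(x^k)-s^k\|\le\theta\|c(x^{k-1})-s^{k-1}\|$, set $\mu_{k+1}=\mu_k$; otherwise select $\mu_{k+1}\in(0,\kappa\mu_k]$.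 It is assumed that the method is well defined, i.e. each step (2) can be carried out, so that an infinite sequence is generated. *)

(* Defs.v *)
From HB Require Import structures.
From mathcomp Require Import all_boot all_order all_algebra.
From mathcomp Require Import all_classical all_reals all_analysis.

Set Implicit Arguments.
Unset Strict Implicit.
Unset Printing Implicit Defensive.

Import Order.TTheory GRing.Theory Num.Theory.
Import numFieldNormedType.Exports.

Local Open Scope classical_set_scope.
Local Open Scope ring_scope.

(* Vectors of R^N are rows 'rV[R]_N, and (x, s) in R^n * R^m is row_mx x s.  *)
(* The library norm on 'rV[R]_N is the max norm: it is used only for the     *)
(* topology, differentiability, boundedness of sets and local Lipschitz      *)
(* continuity, none of which depends on the choice of the norm. All metric   *)
(* quantities are expressed with the Euclidean norm enorm.                   *)
(* A function R^N -> R \cup {oo} is h : 'rV[R]_N -> \bar R that never takes  *)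
(* the value -oo; this is a separate hypothesis where it is needed.          *)

Section Euclidean.
Context {R : realType} {N : nat}.
Implicit Types u v : 'rV[R]_N.

Definition dot u v : R := \sum_(i < N) u 0 i * v 0 i.

Definition enorm u : R := Num.sqrt (dot u u).

End Euclidean.

Section Smoothness.
Context {R : realType} {n m : nat}.

Definition grad (f : 'rV[R]_n -> R) (x : 'rV[R]_n) : 'rV[R]_n :=
  \row_(i < n) 'D_(delta_mx 0 i) f x.

(* The library's 'J c x acts on row vectors (h |-> h *m 'J c x), hence it is *)
(* the transpose of the usual m x n Jacobian.                                *)
Definition nabla (c : 'rV[R]_n -> 'rV[R]_m) (x : 'rV[R]_n) : 'M[R]_(m, n) :=
  ('J c x)^T.

Definition locally_lipschitz (V W : normedModType R) (F : V -> W) : Prop :=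
  forall x : V, lipschitz_on F (nbhs (x, x)).

Definition C11_fun (f : 'rV[R]_n -> R) : Prop :=
  [/\ forall x, differentiable f x, continuous (grad f)
    & locally_lipschitz (grad f)].

Definition C11_map (c : 'rV[R]_n -> 'rV[R]_m) : Prop :=
  [/\ forall x, differentiable c x, continuous (nabla c)
    & locally_lipschitz (nabla c)].

End Smoothness.

Section VariationalAnalysis.
Context {R : realType} {N : nat}.
Implicit Types (h : 'rV[R]_N -> \bar R) (x v z w : 'rV[R]_N)
  (D : set 'rV[R]_N).

Definition edom h : set 'rV[R]_N := [set x | (h x < +oo)%E].

Definition proper_fun h : Prop := edom h !=set0.

Definition prox_bounded h : Prop :=
  proper_fun h /\
  exists2 gamma : R, 0 < gamma &
    exists b : R, forall x, (b%:E <= h x + (enorm x ^+ 2 / (2 * gamma))%:E)%E.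

Definition regular_subdiff h x : set 'rV[R]_N :=
  [set v | edom h x /\
    (0 <= limf_einf (fun z => (h z - h x - (dot v (z - x))%:E)
                               * ((enorm (z - x))^-1)%:E) x^')%E].

Definition limiting_subdiff h x : set 'rV[R]_N :=
  [set v | edom h x /\
    exists (xs vs : nat -> 'rV[R]_N),
      [/\ xs @ \oo --> x, (h \o xs) @ \oo --> h x,
          forall j, regular_subdiff h (xs j) (vs j) & vs @ \oo --> v]].

Definition indicator D x : \bar R := if x \in D then 0%E else +oo%E.

Definition projection D v : set 'rV[R]_N :=
  [set z | D z /\ forall z', D z' -> enorm (z - v) <= enorm (z' - v)].

(* Conic hull, without convexification. *)
Definition conic_hull (A : set 'rV[R]_N) : set 'rV[R]_N :=
  [set w | exists2 t : R, 0 <= t & exists2 a, A a & w = t *: a].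

Definition limiting_normal_cone D z : set 'rV[R]_N :=
  [set w | D z /\
    exists (vs ws : nat -> 'rV[R]_N),
      [/\ vs @ \oo --> z,
          forall j, conic_hull [set vs j - p | p in projection D (vs j)] (ws j)
        & ws @ \oo --> w]].

End VariationalAnalysis.

Section ConstrainedProblem.
Context {R : realType} {n m : nat}.
Variables (q : 'rV[R]_n -> \bar R) (c : 'rV[R]_n -> 'rV[R]_m)
  (D : set 'rV[R]_m).

(* y *m nabla c x is the row vector of (nabla c x)^T y. *)
Definition AM_stationary (xstar : 'rV[R]_n) : Prop :=
  [/\ edom q xstar, D (c xstar) &
    exists (x eta : nat -> 'rV[R]_n) (y zeta : nat -> 'rV[R]_m),
      [/\ x @ \oo --> xstar, (q \o x) @ \oo --> q xstar,
          eta @ \oo --> (0 : 'rV[R]_n), zeta @ \oo --> (0 : 'rV[R]_m) &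
          forall k,
            limiting_subdiff q (x k) (- (y k *m nabla c (x k)) + eta k) /\
            limiting_normal_cone D (c (x k) + zeta k) (y k)]].

Definition aug_lagrangian (mu : R) (x : 'rV[R]_n) (s y : 'rV[R]_m) : \bar R :=
  (q x + indicator D s + (dot y (c x - s))%:E
   + ((2 * mu)^-1 * enorm (c x - s) ^+ 2)%:E)%E.

Definition eps_stationary (mu : R) (y : 'rV[R]_m) (eps : R)
    (x : 'rV[R]_n) (s : 'rV[R]_m) : Prop :=
  exists2 eta : 'rV[R]_(n + m),
    limiting_subdiff
      (fun z => aug_lagrangian mu (lsubmx z) (rsubmx z) y) (row_mx x s) eta
    & enorm eta <= eps.

(* The sequences x, s, yhat, y, mu and eps form a run of the method. *)
Definition alm_run (mu0 theta kappa : R) (Y : set 'rV[R]_m)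
    (x : nat -> 'rV[R]_n) (s yhat y : nat -> 'rV[R]_m) (mu eps : nat -> R)
    : Prop :=
  mu 0%N = mu0 /\
  forall k : nat,
    [/\ Y (yhat k) /\ 0 <= eps k,
        D (s k) /\ eps_stationary (mu k) (yhat k) (eps k) (x k) (s k),
        y k = yhat k + (mu k)^-1 *: (c (x k) - s k),
        (k = 0%N \/ enorm (c (x k) - s k)
                    <= theta * enorm (c (x k.-1) - s k.-1)) ->
          mu k.+1 = mu k
      & ~ (k = 0%N \/ enorm (c (x k) - s k)
                      <= theta * enorm (c (x k.-1) - s k.-1)) ->
          0 < mu k.+1 <= kappa * mu k].

End ConstrainedProblem.

(* Main.v *)
Require Import Defs.
From HB Require Import structures.
From mathcomp Require Import all_boot all_order all_algebra.
From mathcomp Require Import all_classical all_reals all_analysis.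
From mathcomp Require Import ring lra.

Import Order.TTheory GRing.Theory Num.Theory.
Import numFieldNormedType.Exports.

Local Open Scope classical_set_scope.
Local Open Scope ring_scope.

Set Implicit Arguments.
Unset Strict Implicit.
Unset Printing Implicit Defensive.

(** An approximate stationary point of the augmented Lagrangian already
satisfies the AM-stationarity relations, with an error controlled by the
tolerance; the theorem follows by letting that tolerance go to zero.

As a function of (x, s), the augmented Lagrangian is the separable function
q(x) + delta_D(s) plus the smooth term <y, c(x) - s> + |c(x) - s|^2 / (2 mu).
With the updated multiplier Y = y + (c(x) - s) / mu, the gradient of that
smooth term is (nabla c(x)^T Y, - Y) ([penalty_has_gradient]). Smooth summands
shift the limiting subdifferential by their gradient
([limiting_subdiff_addr]), and the limiting subdifferential of
q(x) + delta_D(s) splits into its two components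
([limiting_subdiff_separable_indicator]). Hence a subgradient eta = (eta_x,
eta_s) of the augmented Lagrangian at an iterate gives
eta_x - nabla c(x)^T Y in the subdifferential of q at x, and eta_s + Y in the
subdifferential of delta_D at s ([aug_lagrangian_subdiff]). The latter lies in
the limiting normal cone of D at s ([limiting_subdiff_indicator]): in finite
dimension every regular normal v at s is a limit of scaled proximal normals
(s + t v - p) / t, with p a projection of s + t v, because the distance from s
to p is o(t) as t decreases to 0.

So eta_s + Y serves as the multiplier in the definition of AM-stationarity,
eta_x + nabla c(x)^T eta_s as the dual error, and s - c(x) as the
perturbation of the constraint. Along the given subsequence the last two vanish
because eta tends to 0, nabla c is continuous, and s and c(x) have the same
limit.

Neighbourhoods are those of the max norm while the subdifferentials and
projections use the Euclidean norm. Regular subgradients are therefore first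
characterised by a first-order lower bound whose error is measured in the
max norm ([regular_subdiffP]); the equivalence of the two norms makes this
harmless. *)

(** * Entrywise convergence, scalar product and comparison of norms *)

Section EuclideanLemmas.
Context {R : realType}.

Lemma ler_norm_entry (m n : nat) (A : 'M[R]_(m, n)) i j : `|A i j| <= `|A|.
Proof.
rewrite [leRHS]/Num.Def.normr /= mx_normrE.
exact: (le_bigmax _ (fun ij : 'I_m * 'I_n => `|A ij.1 ij.2|) (i, j)).
Qed.

Lemma mx_norm_le (m n : nat) (A : 'M[R]_(m, n)) (r : R) :
  0 <= r -> (forall i j, `|A i j| <= r) -> `|A| <= r.
Proof.
move=> r0 Ar; rewrite /Num.Def.normr /= mx_normrE.
by apply: bigmax_le => // -[i j] _ /=; exact: Ar.
Qed.

Lemma cvg_mx {T : Type} {F : set_system T} {FF : Filter F} (m n : nat)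
    (A : T -> 'M[R]_(m, n)) (B : 'M[R]_(m, n)) :
  (forall i j, (fun t => A t i j) @ F --> B i j) -> A @ F --> B.
Proof.
move=> AB; apply/cvgrPdist_le => e e0.
have: \forall t \near F, forall i j, `|B i j - A t i j| <= e.
  apply: filter_forall => i; apply: filter_forall => j.
  by have /cvgrPdist_le/(_ e e0) := AB i j.
apply: filterS => t ABt; apply: mx_norm_le; first exact: ltW.
by move=> i j; rewrite !mxE.
Qed.

Lemma cvg_entry {T : Type} {F : set_system T} {FF : Filter F} (m n : nat)
    (A : T -> 'M[R]_(m, n)) (B : 'M[R]_(m, n)) i j :
  A @ F --> B -> (fun t => A t i j) @ F --> B i j.
Proof.
move=> AB; apply: (@cvg_comp _ _ _ A (fun M => M i j) F (nbhs B)) => //.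
exact: coord_continuous.
Qed.

Lemma cvg_sum_ord {T : Type} {F : set_system T} {FF : Filter F} (n : nat)
    (a : T -> 'I_n -> R) (b : 'I_n -> R) :
  (forall i, a^~ i @ F --> b i) ->
  (fun t => \sum_(i < n) a t i) @ F --> \sum_(i < n) b i.
Proof.
move=> ab.
apply: cvg_big => [|i _]; last exact: ab.
by apply: add_continuous.
Qed.

Lemma cvg_dot {T : Type} {F : set_system T} {FF : Filter F} (n : nat)
    (u v : T -> 'rV[R]_n) (a b : 'rV[R]_n) :
  u @ F --> a -> v @ F --> b -> (fun t => dot (u t) (v t)) @ F --> dot a b.
Proof.
by move=> ua vb; apply: cvg_sum_ord => i; apply: cvgM; exact: cvg_entry.
Qed.

Lemma cvg_mulmx {T : Type} {F : set_system T} {FF : Filter F} (m n p : nat)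
    (A : T -> 'M[R]_(m, n)) (B : T -> 'M[R]_(n, p))
    (A0 : 'M[R]_(m, n)) (B0 : 'M[R]_(n, p)) :
  A @ F --> A0 -> B @ F --> B0 -> (fun t => A t *m B t) @ F --> A0 *m B0.
Proof.
move=> AA0 BB0; apply: cvg_mx => i j; under eq_fun do rewrite mxE.
by rewrite mxE; apply: cvg_sum_ord => k; apply: cvgM; exact: cvg_entry.
Qed.

Lemma cvg_lsubmx {T : Type} {F : set_system T} {FF : Filter F} (m n : nat)
    (a : T -> 'rV[R]_(m + n)) (b : 'rV[R]_(m + n)) :
  a @ F --> b -> (fun t => lsubmx (a t)) @ F --> (lsubmx b : 'rV[R]_m).
Proof.
move=> ab; apply: cvg_mx => i j; rewrite mxE; under eq_fun do rewrite mxE.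
exact: cvg_entry.
Qed.

Lemma cvg_rsubmx {T : Type} {F : set_system T} {FF : Filter F} (m n : nat)
    (a : T -> 'rV[R]_(m + n)) (b : 'rV[R]_(m + n)) :
  a @ F --> b -> (fun t => rsubmx (a t)) @ F --> (rsubmx b : 'rV[R]_n).
Proof.
move=> ab; apply: cvg_mx => i j; rewrite mxE; under eq_fun do rewrite mxE.
exact: cvg_entry.
Qed.

Lemma cvg_row_mx {T : Type} {F : set_system T} {FF : Filter F} (m n : nat)
    (u : T -> 'rV[R]_m) (v : T -> 'rV[R]_n) (a : 'rV[R]_m) (b : 'rV[R]_n) :
  u @ F --> a -> v @ F --> b ->
  (fun t => row_mx (u t) (v t)) @ F --> row_mx a b.
Proof.
move=> ua vb; apply: cvg_mx => i j; rewrite mxE; under eq_fun do rewrite mxE.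
by case: (fintype.split j) => k; exact: cvg_entry.
Qed.

Section Dot.
Context {n : nat}.
Implicit Types u v w : 'rV[R]_n.

Lemma dotE u v : dot u v = (u *m v^T) 0 0.
Proof. by rewrite mxE; apply: eq_bigr => i _; rewrite mxE. Qed.

Lemma dotC u v : dot u v = dot v u.
Proof. by apply: eq_bigr => i _; rewrite mulrC. Qed.

Lemma dotDl u v w : dot (u + v) w = dot u w + dot v w.
Proof. by rewrite !dotE mulmxDl mxE. Qed.

Lemma dotDr u v w : dot w (u + v) = dot w u + dot w v.
Proof. by rewrite dotC dotDl !(dotC w). Qed.

Lemma dotZl (a : R) u v : dot (a *: u) v = a * dot u v.
Proof. by rewrite !dotE -scalemxAl mxE. Qed.

Lemma dotZr (a : R) u v : dot u (a *: v) = a * dot u v.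
Proof. by rewrite dotC dotZl dotC. Qed.

Lemma dotNl u v : dot (- u) v = - dot u v.
Proof. by rewrite -scaleN1r dotZl mulN1r. Qed.

Lemma dotNr u v : dot u (- v) = - dot u v.
Proof. by rewrite dotC dotNl dotC. Qed.

Lemma dot0l u : dot 0 u = 0.
Proof. by rewrite -(scale0r 0) dotZl mul0r. Qed.

Lemma dot0r u : dot u 0 = 0.
Proof. by rewrite dotC dot0l. Qed.

Lemma dot_ge0 u : 0 <= dot u u.
Proof. by apply: sumr_ge0 => i _; rewrite -expr2 sqr_ge0. Qed.

Lemma norm_dot_le u v : `|dot u v| <= n%:R * (`|u| * `|v|).
Proof.
have -> : n%:R * (`|u| * `|v|) = \sum_(i < n) `|u| * `|v|.
  by rewrite sumr_const card_ord mulr_natl.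
apply: (le_trans (ler_norm_sum _ _ _)); apply: ler_sum => i _.
by rewrite normrM ler_pM// ler_norm_entry.
Qed.

Lemma enorm_ge0 u : 0 <= enorm u. Proof. exact: sqrtr_ge0. Qed.

Lemma enorm_sqr u : enorm u ^+ 2 = dot u u.
Proof. by rewrite sqr_sqrtr// dot_ge0. Qed.

Lemma norm_le_enorm u : `|u| <= enorm u.
Proof.
apply: mx_norm_le => [|i j]; first exact: enorm_ge0.
rewrite ord1 -sqrtr_sqr ler_wsqrtr// /dot (bigD1 j)//= expr2 lerDl.
by apply: sumr_ge0 => k _; rewrite -expr2 sqr_ge0.
Qed.

(** The constant is crude (the sharp one is the square root of n); only the
equivalence of the two norms matters below. *)
Lemma enorm_le u : enorm u <= n%:R * `|u|.
Proof.
have nu0 : 0 <= n%:R * `|u| by rewrite mulr_ge0.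
rewrite -(ger0_norm nu0) -sqrtr_sqr ler_wsqrtr//.
apply: (le_trans (ler_norm _)); apply: (le_trans (norm_dot_le _ _)).
rewrite expr2 mulrACA -!expr2 ler_wpM2r// ?sqr_ge0//.
by rewrite -natrX ler_nat; case: (n) => // k; rewrite expnS expn1 leq_pmulr.
Qed.

Lemma enorm_continuous : continuous (@enorm R n).
Proof.
move=> u; apply: (@cvg_comp _ _ _ (fun u => dot u u) Num.sqrt _ (nbhs (dot u u))).
  by apply: (@cvg_dot _ (nbhs u) _ _ id id); exact: cvg_id.
exact: sqrt_continuous.
Qed.

End Dot.

Lemma dot_mulmx_tr (m n : nat) (u : 'rV[R]_m) (A : 'M[R]_(n, m)) (v : 'rV[R]_n) :
  dot (u *m A^T) v = dot u (v *m A).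
Proof. by rewrite !dotE trmx_mul mulmxA. Qed.

Lemma dot_row_mx (m n : nat) (u : 'rV[R]_m) (v : 'rV[R]_n) (h : 'rV[R]_(m + n)) :
  dot (row_mx u v) h = dot u (lsubmx h) + dot v (rsubmx h).
Proof.
rewrite /dot big_split_ord /=; congr (_ + _); apply: eq_bigr => i _.
  by rewrite row_mxEl mxE.
by rewrite row_mxEr mxE.
Qed.

Lemma norm_lsubmx_le (m n : nat) (h : 'rV[R]_(m + n)) : `|lsubmx h| <= `|h|.
Proof. by apply: mx_norm_le => // i j; rewrite mxE ler_norm_entry. Qed.

Lemma norm_rsubmx_le (m n : nat) (h : 'rV[R]_(m + n)) : `|rsubmx h| <= `|h|.
Proof. by apply: mx_norm_le => // i j; rewrite mxE ler_norm_entry. Qed.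

Lemma norm_mulmx_le (m n p : nat) (A : 'M[R]_(m, n)) (B : 'M[R]_(n, p)) :
  `|A *m B| <= n%:R * (`|A| * `|B|).
Proof.
apply: mx_norm_le => [|i j]; first by rewrite !mulr_ge0.
have -> : n%:R * (`|A| * `|B|) = \sum_(k < n) `|A| * `|B|.
  by rewrite sumr_const card_ord mulr_natl.
rewrite mxE; apply: (le_trans (ler_norm_sum _ _ _)); apply: ler_sum => k _.
by rewrite normrM ler_pM// ler_norm_entry.
Qed.

End EuclideanLemmas.

(** * Regular subgradients *)

Section RegularSubdiff.
Context {R : realType}.

(** The liminf of difference quotients is replaced by a family of linear lower
bounds that also hold at z = x. This removes the punctured neighbourhood, which
is the trivial filter when N = 0, so that no dimension has to be treated
separately. *)
Lemma regular_subdiffP (N : nat) (h : 'rV[R]_N -> \bar R) (x v : 'rV[R]_N) :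
  h x \is a fin_num ->
  regular_subdiff h x v <->
  forall e : R, 0 < e -> \forall z \near x,
    (h x + (dot v (z - x) - e * `|z - x|)%:E <= h z)%E.
Proof.
move=> /fineK; set a := fine (h x) => hx.
have pos z : z != x -> 0 < enorm (z - x).
  by move=> zx; apply: (lt_le_trans _ (norm_le_enorm _)); rewrite normr_gt0 subr_eq0.
rewrite /regular_subdiff /= limf_einfE; split.
- move=> [_ lim0] e e0.
  have C0 : 0 < N.+1%:R :> R by rewrite ltr0n.
  (* Dividing e by N + 1 pays for passing from the Euclidean norm of the
     quotient to the max norm; N + 1 instead of N keeps the divisor nonzero. *)
  have : ((- (e / N.+1%:R))%:E < ereal_sup [set ereal_inf
     ((fun z => (h z - h x - (dot v (z - x))%:E) * ((enorm (z - x))^-1)%:E) @` V)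
     | V in x^'])%E.
    by apply: lt_le_trans lim0; rewrite lte_fin oppr_lt0 divr_gt0.
  move=> /ereal_sup_gt[_ [V xV <-]] infV.
  move: xV; rewrite /dnbhs /= => xV; near=> z.
  have [->|zx] := eqVneq z x.
    by rewrite subrr normr0 mulr0 dot0r subrr adde0.
  have Vz : V z by move: zx; near: z.
  have : ((- (e / N.+1%:R))%:E <
     (h z - h x - (dot v (z - x))%:E) * ((enorm (z - x))^-1)%:E)%E.
    by apply: (lt_le_trans infV); apply: ereal_inf_lbound; exists z.
  have n0 := pos _ zx; have i0 : 0 < (enorm (z - x))^-1 by rewrite invr_gt0.
  rewrite -hx; case: (h z) => [b| |] /=.
  + rewrite -!EFinB -EFinM lte_fin ltr_pdivlMr// mulNr => /ltW le.
    rewrite -EFinD lee_fin.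
    have : e / N.+1%:R * enorm (z - x) <= e * `|z - x|.
      rewrite -mulrA ler_wpM2l ?(ltW e0)// ler_pdivrMl//.
      by apply: (le_trans (enorm_le _)); rewrite ler_wpM2r// ler_nat.
    by move: le; move: (_ / _ * _) => d; lra.
  + by rewrite leey.
  + by rewrite addNye gt0_mulNye ?lte_fin.
- move=> near_le; split; first by rewrite /edom /= -hx ltry.
  apply/lee_subgt0Pr => e e0; rewrite add0e.
  have {near_le} := near_le e e0 => near_le.
  pose V := [set z | z != x /\
    (h x + (dot v (z - x) - e * `|z - x|)%:E <= h z)%E].
  apply: le_ereal_sup_tmp; eexists; first exists V; [|by []|].
    by rewrite /dnbhs /within /=; apply: filterS near_le.
  apply: le_ereal_inf_tmp => _ [z [zx hz] <-].
  have n0 := pos _ zx; have i0 : 0 < (enorm (z - x))^-1 by rewrite invr_gt0.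
  move: hz; rewrite -hx; case: (h z) => [b| |] /=.
  + rewrite -EFinD -!EFinB -EFinM !lee_fin => le.
    rewrite ler_pdivlMr//.
    have : e * `|z - x| <= e * enorm (z - x).
      by rewrite ler_wpM2l ?(ltW e0)// norm_le_enorm.
    by move: le; lra.
  + by move=> _; rewrite !addye// gt0_mulye ?lte_fin// leey.
  + by rewrite leeNy_eq.
Unshelve. all: by end_near. Qed.

(** Differentiability in the form that combines directly with
[regular_subdiffP]. *)
Definition has_gradient {N : nat} (F : 'rV[R]_N -> R) (x G : 'rV[R]_N) :=
  forall e : R, 0 < e -> \forall z \near x,
    `|F z - F x - dot G (z - x)| <= e * `|z - x|.

Lemma regular_subdiff_addr (N : nat) (h : 'rV[R]_N -> \bar R)
    (F : 'rV[R]_N -> R) (x v G : 'rV[R]_N) :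
  h x \is a fin_num -> has_gradient F x G ->
  regular_subdiff (fun z => h z + (F z)%:E)%E x v ->
  regular_subdiff h x (v - G).
Proof.
move=> hx FG /regular_subdiffP vhF; apply/regular_subdiffP => // e e0.
have e20 : 0 < e / 2 by rewrite divr_gt0.
have {}vhF := vhF _ _ e20; rewrite fin_numD hx /= in vhF.
have := vhF isT; apply: filterS2 (FG _ e20) => z; rewrite dotDl dotNl.
rewrite -(fineK hx); case: (h z) => [b| |] //=; last by move=> _ _; rewrite leey.
rewrite -!EFinD !lee_fin ler_norml => /andP[FG1 FG2].
move: FG1 FG2; move: (dot _ _) (dot _ _) (`|_|) => p q r; lra.
Qed.

Lemma norm_row_mx0 (n m : nat) (x : 'rV[R]_n) : `|row_mx x (0 : 'rV[R]_m)| <= `|x|.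
Proof.
apply: mx_norm_le => // i j; rewrite mxE.
by case: (fintype.split j) => k; rewrite ?mxE ?normr0 ?ler_norm_entry.
Qed.

Lemma norm_row_0mx (n m : nat) (s : 'rV[R]_m) : `|row_mx (0 : 'rV[R]_n) s| <= `|s|.
Proof.
apply: mx_norm_le => // i j; rewrite mxE.
by case: (fintype.split j) => k; rewrite ?mxE ?normr0 ?ler_norm_entry.
Qed.

(** Moving only one block of coordinates keeps the other summand constant, and
that summand cancels because it is finite. *)
Lemma regular_subdiff_separable (n m : nat) (h1 : 'rV[R]_n -> \bar R)
    (h2 : 'rV[R]_m -> \bar R) (z v : 'rV[R]_(n + m)) :
  h1 (lsubmx z) \is a fin_num -> h2 (rsubmx z) \is a fin_num ->
  regular_subdiff (fun z => h1 (lsubmx z) + h2 (rsubmx z))%E z v ->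
  regular_subdiff h1 (lsubmx z) (lsubmx v) /\
  regular_subdiff h2 (rsubmx z) (rsubmx v).
Proof.
rewrite -[z in X in _ -> _ -> X -> _]hsubmxK -[v in X in _ -> _ -> X -> _]hsubmxK.
move: (lsubmx z) (rsubmx z) (lsubmx v) (rsubmx v) => x s vx vs {z v} h1x h2s.
move=> /regular_subdiffP; rewrite row_mxKl row_mxKr fin_numD h1x h2s.
move=> /(_ isT) v12; split; apply/regular_subdiffP => // e e0.
- have row_x : (fun z => row_mx z s) @ nbhs x --> row_mx x s.
    by apply: cvg_row_mx; [exact: cvg_id | exact: cvg_cst].
  have near_x := row_x _ (v12 e e0).
  move: near_x; apply: (@filterS _ (nbhs x)) => z /=.
  rewrite opp_row_mx add_row_mx subrr !row_mxKl !row_mxKr dot_row_mx.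
  rewrite row_mxKl row_mxKr dot0r addr0 addeAC leeD2rE// => le.
  apply: le_trans le; rewrite leeD2l// lee_fin lerD2l lerN2 ler_wpM2l ?(ltW e0)//.
  exact: norm_row_mx0.
- have row_s : (fun z => row_mx x z) @ nbhs s --> row_mx x s.
    by apply: cvg_row_mx; [exact: cvg_cst | exact: cvg_id].
  have near_s := row_s _ (v12 e e0).
  move: near_s; apply: (@filterS _ (nbhs s)) => z /=.
  rewrite opp_row_mx add_row_mx subrr !row_mxKl !row_mxKr dot_row_mx.
  rewrite row_mxKl row_mxKr dot0r add0r -addeA leeD2lE// => le.
  apply: le_trans le; rewrite leeD2l// lee_fin lerD2l lerN2 ler_wpM2l ?(ltW e0)//.
  exact: norm_row_0mx.
Qed.

End RegularSubdiff.

(** * Limiting subgradients *)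

Section LimitingSubdiff.
Context {R : realType}.

Lemma has_gradient_continuous (N : nat) (F : 'rV[R]_N -> R) (x G : 'rV[R]_N) :
  has_gradient F x G -> F @ x --> F x.
Proof.
move=> FG; apply/(@cvgrPdist_le _ _ _ (nbhs x)) => e e0.
pose K := 1 + N%:R * `|G|.
have K0 : 0 < K by rewrite ltr_pwDl// mulr_ge0.
have eK0 : 0 < e / K by rewrite divr_gt0.
have near_x : \forall z \near x, `|x - z| <= e / K.
  have idx : id @ nbhs x --> x by exact: cvg_id.
  by have /cvgrPdist_le/(_ _ eK0) := idx.
near=> z.
have le1 : `|F z - F x - dot G (z - x)| <= 1 * `|z - x|.
  by near: z; exact: FG.
have le2 : `|z - x| <= e / K.
  by rewrite distrC; near: z.
have le3 := norm_dot_le G (z - x).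
have : `|F z - F x| <= K * `|z - x|.
  rewrite -(subrK (dot G (z - x)) (F z - F x)).
  apply: (le_trans (ler_normD _ _)); rewrite /K mulrDl lerD//.
  by rewrite -mulrA.
rewrite distrC => /le_trans; apply.
by rewrite mulrC -ler_pdivlMr.
Unshelve. all: by end_near. Qed.

(** Besides the exact rule for regular subgradients, the limit process needs
continuity of both F and its gradient: that of F turns h + F attentive
convergence into h attentive convergence. *)
Lemma limiting_subdiff_addr (N : nat) (h : 'rV[R]_N -> \bar R)
    (F : 'rV[R]_N -> R) (G : 'rV[R]_N -> 'rV[R]_N) (x v : 'rV[R]_N) :
  (forall z, h z <> -oo%E) -> (forall z, has_gradient F z (G z)) ->
  G @ x --> G x ->
  limiting_subdiff (fun z => h z + (F z)%:E)%E x v ->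
  limiting_subdiff h x (v - G x).
Proof.
move=> hNy FG Gx [domx [xs [vs [xsx hxs reg vsv]]]].
have fin z : edom (fun z => h z + (F z)%:E)%E z -> h z \is a fin_num.
  by rewrite /edom /=; have := hNy z; case: (h z).
have hfin := fin _ domx.
split; first by rewrite /edom /= ltey_eq hfin.
exists xs, (fun j => vs j - G (xs j)); split => //.
- have -> : h \o xs = (fun j => (h (xs j) + (F (xs j))%:E) - (F (xs j))%:E)%E.
    by apply/funext => j /=; rewrite addeK.
  rewrite -[h x](@addeK _ (F x)%:E)//.
  apply: cvgeB => //; first by rewrite fin_num_adde_defl.
  apply: cvg_EFin; first by near=> j.
  exact: continuous_cvg _ (has_gradient_continuous (FG x)) xsx.
- move=> j; apply: (regular_subdiff_addr _ (FG (xs j))); last exact: reg.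
  by apply: fin; case: (reg j).
- apply: cvgB => //; exact: continuous_cvg.
Unshelve. all: by end_near. Qed.

(** Convergence of a sum of function values need not give convergence of each
summand. With an indicator it does: regular subgradients exist only at points
of the domain, where the indicator vanishes, so all the values come from q. *)
Lemma limiting_subdiff_separable_indicator (n m : nat) (q : 'rV[R]_n -> \bar R)
    (D : set 'rV[R]_m) (z v : 'rV[R]_(n + m)) :
  (forall x, q x <> -oo%E) ->
  limiting_subdiff (fun z => q (lsubmx z) + indicator D (rsubmx z))%E z v ->
  limiting_subdiff q (lsubmx z) (lsubmx v) /\
  limiting_subdiff (indicator D) (rsubmx z) (rsubmx v).
Proof.
move=> qNy [domz [zs [vs [zsz hzs reg vsv]]]].
have dom t : edom (fun z => q (lsubmx z) + indicator D (rsubmx z))%E t ->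
    q (lsubmx t) \is a fin_num /\ indicator D (rsubmx t) = 0%E.
  rewrite /edom /indicator /=; have := qNy (lsubmx t).
  by case: (q _) => [a| |]//; case: ifP.
have [qz Dz] := dom _ domz.
have domj j := dom _ (reg j).1.
have sep j : regular_subdiff q (lsubmx (zs j)) (lsubmx (vs j)) /\
    regular_subdiff (indicator D) (rsubmx (zs j)) (rsubmx (vs j)).
  have [qj Dj] := domj j.
  by apply: regular_subdiff_separable; rewrite ?qj ?Dj//; exact: reg.
split; (split; first by rewrite /edom /= ?Dz ?ltey_eq ?qz).
- exists (fun j => lsubmx (zs j)), (fun j => lsubmx (vs j)); split => //.
  + exact: cvg_lsubmx.
  + have Eq : (fun z => q (lsubmx z) + indicator D (rsubmx z))%E \o zs =
        q \o (fun j => lsubmx (zs j)).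
      by apply/funext => j /=; rewrite (domj j).2 adde0.
    by move: hzs; rewrite Eq Dz adde0.
  + by move=> j; case: (sep j).
  + exact: cvg_lsubmx.
- exists (fun j => rsubmx (zs j)), (fun j => rsubmx (vs j)); split => //.
  + exact: cvg_rsubmx.
  + rewrite Dz; have -> : indicator D \o (fun j => rsubmx (zs j)) = cst 0%E.
      by apply/funext => j /=; rewrite (domj j).2.
    exact: cvg_cst.
  + by move=> j; case: (sep j).
  + exact: cvg_rsubmx.
Qed.

End LimitingSubdiff.

(** * Normals as limits of proximal normals *)

Section NormalCone.
Context {R : realType} {N : nat}.
Implicit Types (D : set 'rV[R]_N) (s v : 'rV[R]_N).

(** Minimise the distance over the points of D that are no farther from v than
some fixed point of D: they form a compact set. *)
Lemma projection_exists D v : closed D -> D !=set0 -> projection D v !=set0.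
Proof.
move=> Dcl [d Dd].
pose dist (z : 'rV[R]_N) := enorm (z - v).
have dist_cont : continuous dist.
  move=> z; apply: (@continuous_cvg _ _ _ (nbhs z) _ (fun z => z - v) (@enorm R N)).
    exact: enorm_continuous.
  by apply: cvgB; [exact: cvg_id | exact: cvg_cst].
pose A := D `&` [set z | dist z <= dist d].
have A0 : A !=set0 by exists d; split => //=.
have Acomp : compact A.
  apply: bounded_closed_compact.
    exists (dist d + `|v|); split; first exact: num_real.
    move=> M ltM z [_ /= dz]; apply: le_trans (ltW ltM).
    rewrite -(subrK v z); apply: (le_trans (ler_normD _ _)); rewrite lerD2r.
    exact: (le_trans (norm_le_enorm _)).
  apply: closedI => //.
  apply: (@preimage_closed _ _ dist [set r | r <= dist d]).
    by apply: in1W; exact: dist_cont.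
  exact: closed_le.
have [p pA minp] := EVT_min_rV A0 Acomp (continuous_subspaceT dist_cont).
have [Dp pd] := set_mem pA.
exists p; split => // z Dz; have [zd|/ltW dz] := leP (dist z) (dist d).
  by apply: minp; apply/mem_set.
exact: le_trans pd dz.
Qed.

(** Expanding the squares turns the optimality of a projection s + a of
s + t *: v, compared with s, into an inequality to which a bound on
dot v a can be applied. *)
Lemma dot_le_of_closer (a v : 'rV[R]_N) (t : R) :
  enorm (a - t *: v) <= enorm (- (t *: v)) -> dot a a <= 2 * t * dot v a.
Proof.
move=> /(lerXn2r 2); rewrite !nnegrE !enorm_ge0 !enorm_sqr => /(_ isT isT).
rewrite !(dotDl, dotDr, dotNl, dotNr, dotZl, dotZr) (dotC a v).
by move: (dot _ _) (dot _ _) (dot _ _) => x y z; lra.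
Qed.

(** Let p be a projection of s + t *: v and a = p - s. Comparing p with s gives
|a|^2 <= 2 t <v, a>, so that |a| = O(t); hence p is close to s, where
regularity yields <v, a> <= (e / 2) |a|, and so |a| <= t e. The proximal
normal (s + t *: v - p) / t = v - a / t is therefore within e of v. *)
Lemma regular_normal_approx D s v (e : R) : closed D -> 0 < e ->
  regular_subdiff (indicator D) s v ->
  exists v' w, [/\ `|v' - s| <= e, `|w - v| <= e &
    conic_hull [set v' - p | p in projection D v'] w].
Proof.
move=> Dcl e0 reg.
have Ds : D s.
  by case: reg; rewrite /edom /indicator /=; case: ifPn => // /set_mem.
have inds z : D z -> indicator D z = 0%E.
  by move=> Dz; rewrite /indicator mem_set.
have e20 : 0 < e / 2 by rewrite divr_gt0.
have /regular_subdiffP := reg; rewrite inds// => /(_ isT _ e20).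
move=> /nbhs_ballP[d /= d0 ball_d].
have {ball_d} small z : D z -> `|z - s| < d -> dot v (z - s) <= e / 2 * `|z - s|.
  move=> Dz zd; have := ball_d z; rewrite -ball_normE /= distrC => /(_ zd).
  by rewrite !inds// add0e lee_fin subr_le0.
(* A single scale for t: K bounds both |v| and the constant in |a| = O(t),
   so t K <= e controls the base point and t K < d the projection. *)
pose K := 1 + 2 * N%:R * `|v| + `|v|.
have K0 : 0 < K by rewrite /K -addrA ltr_pwDl// addr_ge0// !mulr_ge0.
pose t := Num.min (e / K) (d / (2 * K)).
have t0 : 0 < t by rewrite lt_min !divr_gt0// mulr_gt0.
have tK : t * K <= e by rewrite -ler_pdivlMr// ge_min lexx.
have tKd : t * K < d.
  have : t * (2 * K) <= d by rewrite -ler_pdivlMr ?mulr_gt0// ge_min lexx orbT.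
  have : 0 < t * K by rewrite mulr_gt0.
  move: d0; lra.
have [p [Dp minp]] := @projection_exists D (s + t *: v) Dcl (ex_intro _ s Ds).
pose a := p - s.
have sqle : dot a a <= 2 * t * dot v a.
  apply: dot_le_of_closer.
  by have := minp s Ds; rewrite opprD !addrA subrr sub0r.
have norm_a_sq : `|a| ^+ 2 <= dot a a.
  by rewrite -enorm_sqr lerXn2r ?nnegrE ?enorm_ge0// norm_le_enorm.
have norm_a_le : `|a| <= t * (2 * N%:R * `|v|).
  have [->|a0] := eqVneq `|a| 0; first by rewrite !mulr_ge0// ltW.
  rewrite -(ler_pM2r (_ : 0 < `|a|)); last by rewrite lt_def a0 normr_ge0.
  rewrite -expr2; apply: (le_trans norm_a_sq); apply: (le_trans sqle).
  have := ler_norm (dot v a); have := norm_dot_le v a.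
  move=> /[swap] /le_trans /[apply] le_va.
  have : t * dot v a <= t * (N%:R * (`|v| * `|a|)) by rewrite ler_pM2l.
  by move: (dot v a) => x; lra.
have a_small : `|a| < d.
  apply: (le_lt_trans norm_a_le); apply: le_lt_trans tKd.
  rewrite ler_pM2l// /K; have := normr_ge0 v; lra.
have le_va := small p Dp a_small.
have norm_a_te : `|a| <= t * e.
  have [->|a0] := eqVneq `|a| 0; first by rewrite mulr_ge0// ltW.
  rewrite -(ler_pM2r (_ : 0 < `|a|)); last by rewrite lt_def a0 normr_ge0.
  rewrite -expr2; apply: (le_trans norm_a_sq); apply: (le_trans sqle).
  have : t * dot v a <= t * (e / 2 * `|a|) by rewrite ler_pM2l.
  by move: (dot v a) => x; lra.
exists (s + t *: v), (t^-1 *: (t *: v - a)); split.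
- rewrite addrC addKr normrZ gtr0_norm//; apply: le_trans tK.
  rewrite ler_pM2l// /K.
  have : 0 <= 2 * N%:R * `|v| by rewrite !mulr_ge0.
  lra.
- rewrite scalerBr scalerA mulVf ?gt_eqF// scale1r addrC addKr normrN normrZ.
  by rewrite gtr0_norm ?invr_gt0// ler_pdivrMl.
- exists t^-1; first by rewrite invr_ge0 ltW.
  exists (t *: v - a) => //; exists p => //.
  by rewrite /a opprB addrCA addrA.
Qed.

(** A diagonal argument: every regular normal of the defining sequence is
replaced by a proximal one at distance at most 1 / (j + 1). *)
Lemma limiting_subdiff_indicator D s v : closed D ->
  limiting_subdiff (indicator D) s v -> limiting_normal_cone D s v.
Proof.
move=> Dcl [doms [xs [vs [xss _ reg vsv]]]]; split.
  by move: doms; rewrite /edom /indicator /=; case: ifPn => // /set_mem.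
have approx (j : nat) : exists vw : 'rV[R]_N * 'rV[R]_N,
    [/\ `|vw.1 - xs j| <= harmonic j, `|vw.2 - vs j| <= harmonic j &
      conic_hull [set vw.1 - p | p in projection D vw.1] vw.2].
  have [v' [w [? ? ?]]] := regular_normal_approx Dcl (harmonic_gt0 j) (reg j).
  by exists (v', w).
have [vw vwP] := choice approx.
have cvg_harm (u u' : nat -> 'rV[R]_N) (a : 'rV[R]_N) :
    (forall j, `|u' j - u j| <= harmonic j) -> u @ \oo --> a -> u' @ \oo --> a.
  move=> uu' ua; rewrite -(add0r a).
  have -> : u' = (fun j => (u' j - u j) + u j).
    by apply/funext => j; rewrite subrK.
  apply: cvgD => //.
  apply/cvgr0Pnorm_le => r r0.
  have /cvgr0Pnorm_le/(_ _ r0) := @cvg_harmonic R; apply: filterS => j.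
  apply: le_trans; rewrite [leRHS]ger0_norm ?harmonic_ge0//; exact: uu'.
exists (fun j => (vw j).1), (fun j => (vw j).2); split.
- by apply: cvg_harm xss => j; case: (vwP j).
- by move=> j; case: (vwP j).
- by apply: cvg_harm vsv => j; case: (vwP j).
Qed.

End NormalCone.

(** * The smooth part of the augmented Lagrangian *)

Section Penalty.
Context {R : realType} {n m : nat}.
Context (c : 'rV[R]_n -> 'rV[R]_m).

(** The smooth part of the augmented Lagrangian is the quadratic
<y, .> + k |.|^2, k = 1 / (2 mu), composed with c(x) - s. Below, u is the value
of c(x) - s, whose gradient coefficient is y + 2 k u; a and b are the linear
increments of c(x) and of s, and r is the first-order error of c. *)
Lemma quadratic_expansion (k : R) (y u d a b r : 'rV[R]_m) : d = a - b + r ->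
  dot y (u + d) + k * dot (u + d) (u + d) - (dot y u + k * dot u u)
    - (dot (y + (2 * k) *: u) a - dot (y + (2 * k) *: u) b)
  = dot (y + (2 * k) *: u) r + k * dot d d.
Proof.
move=> dE; have -> : r = d - a + b.
  by rewrite dE; apply/rowP => i; rewrite !mxE; ring.
by rewrite !(dotDl, dotDr, dotNr, dotZl) (dotC d u); ring.
Qed.

Lemma jacobian_expansion (x : 'rV[R]_n) (e : R) : differentiable c x -> 0 < e ->
  \forall x' \near x, `|c x' - c x - (x' - x) *m 'J c x| <= e * `|x' - x|.
Proof.
move=> [[_ /eqaddoP dc]] e0; have {}dc := dc _ e0.
rewrite lim_id in dc; last exact: norm_hausdorff.
move: dc; apply: (@filterS _ (nbhs x)) => x'.
rewrite /= opprD /cst addrA /jacobian mul_rV_lin1; exact.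
Qed.

Definition penalty_term (mu : R) (y : 'rV[R]_m) (z : 'rV[R]_(n + m)) : R :=
  dot y (c (lsubmx z) - rsubmx z)
  + (2 * mu)^-1 * enorm (c (lsubmx z) - rsubmx z) ^+ 2.

Definition multiplier (mu : R) (y : 'rV[R]_m) (z : 'rV[R]_(n + m)) : 'rV[R]_m :=
  y + mu^-1 *: (c (lsubmx z) - rsubmx z).

Definition penalty_grad (mu : R) (y : 'rV[R]_m) (z : 'rV[R]_(n + m)) :=
  row_mx (multiplier mu y z *m nabla c (lsubmx z)) (- multiplier mu y z).

(** By [quadratic_expansion] the remainder consists of the first-order error r of
c, paired with the multiplier, and of a term quadratic in the displacement.
Each is made at most (e / 2) |h|: the first by the differentiability of c, the
second by restricting to small displacements h. *)
Lemma penalty_has_gradient (mu : R) (y : 'rV[R]_m) (z : 'rV[R]_(n + m)) :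
  differentiable c (lsubmx z) ->
  has_gradient (penalty_term mu y) z (penalty_grad mu y z).
Proof.
move=> dc e e0.
pose w z := c (lsubmx z) - rsubmx z : 'rV[R]_m.
pose L := m%:R * `|multiplier mu y z|.
(* J bounds the displacement of c(x) - s: the jacobian, plus 1 for s and 1
   for the error of the expansion, whose rate e1 is at most 1. *)
pose J := n%:R * `|'J c (lsubmx z)| + 2.
pose Q := m%:R * `|(2 * mu)^-1| * J ^+ 2.
have muE : mu^-1 = 2 * (2 * mu)^-1 by rewrite invfM mulrA divff ?mul1r ?pnatr_eq0.
have L0 : 0 <= L by rewrite mulr_ge0.
have J0 : 0 <= J by rewrite addr_ge0// mulr_ge0.
have Q0 : 0 <= Q by rewrite !mulr_ge0// sqr_ge0.
pose e1 := Num.min 1 (e / (2 * (L + 1))).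
have e10 : 0 < e1 by rewrite lt_min ltr01 divr_gt0// mulr_gt0// ltr_wpDl.
have e2 : 0 < e / (2 * (Q + 1)) by rewrite divr_gt0// mulr_gt0// ltr_wpDl.
have halve K : 0 <= K -> (K + 1) * (e / (2 * (K + 1))) = e / 2.
  by move=> K0; field; rewrite gt_eqF// ltr_wpDl.
have near_c : \forall z' \near z,
    `|c (lsubmx z') - c (lsubmx z) - (lsubmx z' - lsubmx z) *m 'J c (lsubmx z)|
      <= e1 * `|lsubmx z' - lsubmx z|.
  have lz : lsubmx @ nbhs z --> lsubmx z.
    by apply: (@cvg_lsubmx _ _ (nbhs z) _ _ _ id); exact: cvg_id.
  exact: lz _ (jacobian_expansion dc e10).
have near_z : \forall z' \near z, `|z' - z| <= e / (2 * (Q + 1)).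
  have idz : id @ nbhs z --> z by exact: cvg_id.
  have /cvgrPdist_le/(_ _ e2) := idz.
  by apply: filterS => z'; rewrite distrC.
apply: filterS2 near_c near_z => z'.
have hE : lsubmx z' - lsubmx z = lsubmx (z' - z) by rewrite linearB.
have kE : rsubmx z' - rsubmx z = rsubmx (z' - z) by rewrite linearB.
rewrite hE; set h := z' - z.
set r := _ - _ *m _ => r_le h_le.
have {}r_le : `|r| <= e1 * `|h|.
  by apply: (le_trans r_le); rewrite ler_wpM2l ?(ltW e10)// norm_lsubmx_le.
pose d := w z' - w z.
have dE : d = lsubmx h *m 'J c (lsubmx z) - rsubmx h + r.
  rewrite /d /w /r -kE; move: (c _) (c _) (_ *m _) => a b u.
  by apply/rowP => i; rewrite !mxE; ring.
have d_le : `|d| <= J * `|h|.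
  rewrite dE; apply: (le_trans (ler_normD _ _)).
  apply: (@le_trans _ _ (n%:R * `|'J c (lsubmx z)| * `|h| + `|h| + `|h|)); last first.
    by rewrite /J; lra.
  apply: lerD; last first.
    apply: (le_trans r_le); rewrite -[leRHS]mul1r ler_wpM2r// ge_min lexx//.
  apply: (le_trans (ler_normB _ _)); apply: lerD; last exact: norm_rsubmx_le.
  apply: (le_trans (norm_mulmx_le _ _)).
  by rewrite (mulrC `|lsubmx h|) mulrA ler_wpM2l ?mulr_ge0// norm_lsubmx_le.
have -> : penalty_term mu y z' - penalty_term mu y z - dot (penalty_grad mu y z) h =
    dot (multiplier mu y z) r + (2 * mu)^-1 * dot d d.
  rewrite /penalty_term /penalty_grad !enorm_sqr -/(w z') -/(w z).
  rewrite dot_row_mx dot_mulmx_tr dotNl /multiplier -/(w z) muE.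
  have -> : w z' = w z + d by rewrite addrC subrK.
  by rewrite (quadratic_expansion _ _ _ dE).
apply: (le_trans (ler_normD _ _)); rewrite normrM.
have Lr : `|dot (multiplier mu y z) r| <= e / 2 * `|h|.
  apply: (le_trans (norm_dot_le _ _)); rewrite mulrA -/L.
  apply: (@le_trans _ _ (L * (e1 * `|h|))); first by rewrite ler_wpM2l.
  rewrite mulrA ler_wpM2r//.
  apply: (@le_trans _ _ ((L + 1) * (e / (2 * (L + 1))))).
    apply: ler_pM => //; [exact: ltW|by rewrite lerDl|by rewrite ge_min lexx orbT].
  by rewrite halve.
have Qd : `|(2 * mu)^-1| * `|dot d d| <= e / 2 * `|h|.
  apply: (@le_trans _ _ (Q * `|h| * `|h|)).
    rewrite /Q -!mulrA [leRHS]mulrCA ler_wpM2l//.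
    apply: (le_trans (norm_dot_le _ _)); rewrite ler_wpM2l//.
    apply: (@le_trans _ _ ((J * `|h|) * (J * `|h|))); first by rewrite ler_pM.
    by rewrite -mulrA ler_wpM2l// mulrCA.
  rewrite ler_wpM2r//.
  apply: (@le_trans _ _ ((Q + 1) * (e / (2 * (Q + 1))))).
    by apply: ler_pM => //; rewrite lerDl.
  by rewrite halve.
by rewrite (le_trans (lerD Lr Qd))// -mulrDl -splitr.
Qed.

Lemma penalty_grad_cvg (mu : R) (y : 'rV[R]_m) (z : 'rV[R]_(n + m)) :
  (forall x, differentiable c x) -> continuous (nabla c) ->
  penalty_grad mu y @ z --> penalty_grad mu y z.
Proof.
move=> dc nc.
have lz : lsubmx @ nbhs z --> (lsubmx z : 'rV[R]_n).
  by apply: (@cvg_lsubmx _ _ (nbhs z) _ _ _ id); exact: cvg_id.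
have rz : rsubmx @ nbhs z --> (rsubmx z : 'rV[R]_m).
  by apply: (@cvg_rsubmx _ _ (nbhs z) _ _ _ id); exact: cvg_id.
have cz : (fun z' => c (lsubmx z')) @ nbhs z --> c (lsubmx z).
  exact: (continuous_cvg _ (differentiable_continuous (dc (lsubmx z))) lz).
have nz : (fun z' => nabla c (lsubmx z')) @ nbhs z --> nabla c (lsubmx z).
  exact: (continuous_cvg _ (nc (lsubmx z)) lz).
have mz : multiplier mu y @ nbhs z --> multiplier mu y z.
  apply: cvgD; first exact: cvg_cst.
  by apply: cvgZr; exact: cvgB.
by apply: (@cvg_row_mx _ _ (nbhs z)); [exact: cvg_mulmx | exact: cvgN].
Qed.

Lemma aug_lagrangian_subdiff (q : 'rV[R]_n -> \bar R) (D : set 'rV[R]_m)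
    (mu : R) (y : 'rV[R]_m) (z eta : 'rV[R]_(n + m)) :
  (forall x, q x <> -oo%E) ->
  (forall x, differentiable c x) -> continuous (nabla c) ->
  limiting_subdiff
    (fun z => aug_lagrangian q c D mu (lsubmx z) (rsubmx z) y) z eta ->
  limiting_subdiff q (lsubmx z)
    (lsubmx eta - multiplier mu y z *m nabla c (lsubmx z)) /\
  limiting_subdiff (indicator D) (rsubmx z) (rsubmx eta + multiplier mu y z).
Proof.
move=> qNy dc nc.
have -> : (fun z => aug_lagrangian q c D mu (lsubmx z) (rsubmx z) y) =
    (fun z => (q (lsubmx z) + indicator D (rsubmx z)) + (penalty_term mu y z)%:E)%E.
  by apply/funext => z'; rewrite /aug_lagrangian EFinD addeA.
move=> /(limiting_subdiff_addr (h := fun z => _ (lsubmx z) + _)%E).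
move=> /(_ (penalty_grad mu y)) L.
have hNy z' : (q (lsubmx z') + indicator D (rsubmx z'))%E <> -oo%E.
  have := qNy (lsubmx z'); rewrite /indicator.
  by case: (q _) => [a||]//; case: ifP.
have has_grad z' := @penalty_has_gradient mu y z' (dc (lsubmx z')).
have := L hNy has_grad (penalty_grad_cvg dc nc).
move=> /(limiting_subdiff_separable_indicator qNy).
by rewrite !linearB /= row_mxKl row_mxKr opprK.
Qed.

End Penalty.

(** * Asymptotic stationarity of accumulation points *)

Unset Implicit Arguments.

Theorem theorem3p3 (R : realType) (n m : nat)
  (f : 'rV[R]_n -> R) (c : 'rV[R]_n -> 'rV[R]_m)
  (g : 'rV[R]_n -> \bar R) (D : set 'rV[R]_m)
  (f_C11 : C11_fun f) (c_C11 : C11_map c)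
  (g_ninfty : forall x, g x <> -oo%E)
  (g_proper : proper_fun g) (g_lsc : lower_semicontinuous g)
  (g_prox : prox_bounded g)
  (D_nonempty : D !=set0) (D_closed : closed D)
  (mu0 theta kappa : R) (Y : set 'rV[R]_m)
  (mu0_gt0 : 0 < mu0) (theta_01 : 0 < theta < 1) (kappa_01 : 0 < kappa < 1)
  (Y_nonempty : Y !=set0) (Y_bounded : bounded_set Y)
  (x : nat -> 'rV[R]_n) (s yhat y : nat -> 'rV[R]_m) (mu eps : nat -> R)
  (xstar : 'rV[R]_n) (phi : nat -> nat) :
  let q : 'rV[R]_n -> \bar R := fun z => ((f z)%:E + g z)%E in
  alm_run q c D mu0 theta kappa Y x s yhat y mu eps ->
  eps @ \oo --> (0 : R) ->
  cluster ((fun k => (x k, s k)) @ \oo) (xstar, c xstar) ->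
  edom q xstar -> D (c xstar) ->
  increasing_seq phi ->
  (x \o phi) @ \oo --> xstar ->
  (q \o (x \o phi)) @ \oo --> q xstar ->
  (s \o phi) @ \oo --> c xstar ->
  AM_stationary q c D xstar.
Proof.
move=> q run eps0 _ qstar Dstar phi_incr xstar_lim qstar_lim sstar_lim.
have [c_diff nabla_cont _] := c_C11.
have qNy z : q z <> -oo%E by rewrite /q; have := g_ninfty z; case: (g z).
(* The multiplier of [aug_lagrangian_subdiff] at an iterate is exactly the
   updated y k of the method. *)
have stationary k : exists eta : 'rV[R]_(n + m),
    [/\ `|eta| <= eps k,
      limiting_subdiff q (x k) (lsubmx eta - y k *m nabla c (x k)) &
      limiting_subdiff (indicator D) (s k) (rsubmx eta + y k)].
  have [_ [_ [eta eta_sub eta_le]] yE _ _] := run.2 k.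
  exists eta; split; first exact: le_trans (norm_le_enorm eta) eta_le.
    have [+ _] := aug_lagrangian_subdiff qNy c_diff nabla_cont eta_sub.
    by rewrite /multiplier !row_mxKl row_mxKr -yE.
  have [_ +] := aug_lagrangian_subdiff qNy c_diff nabla_cont eta_sub.
  by rewrite /multiplier !row_mxKl row_mxKr -yE.
have [eta etaP] := choice stationary.
have eta_lim : eta \o phi @ \oo --> (0 : 'rV[R]_(n + m)).
  apply/cvgr0Pnorm_le => e e0.
  have /cvgr0Pnorm_le/(_ _ e0) [K _ Keps] := eps0.
  exists K => // k /= Kk; have [eta_le _ _] := etaP (phi k).
  apply: le_trans (eta_le) _; apply: le_trans (ler_norm _) _; apply: Keps => /=.
  have phi_ge j : (j <= phi j)%N.
    elim: j => // j IH; apply: (leq_ltn_trans IH).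
    by rewrite ltnNge -leEnat phi_incr ltnn.
  exact: leq_trans Kk (phi_ge k).
have eta_x_lim : (fun k => lsubmx (eta (phi k))) @ \oo --> (0 : 'rV[R]_n).
  have -> : 0 = lsubmx (0 : 'rV[R]_(n + m)) by apply/rowP => i; rewrite !mxE.
  exact: cvg_lsubmx.
have eta_s_lim : (fun k => rsubmx (eta (phi k))) @ \oo --> (0 : 'rV[R]_m).
  have -> : 0 = rsubmx (0 : 'rV[R]_(n + m)) by apply/rowP => i; rewrite !mxE.
  exact: cvg_rsubmx.
have cx_lim : (fun k => c (x (phi k))) @ \oo --> c xstar.
  exact: (continuous_cvg _ (differentiable_continuous (c_diff xstar)) xstar_lim).
have nabla_lim : (fun k => nabla c (x (phi k))) @ \oo --> nabla c xstar.
  exact: (continuous_cvg _ (nabla_cont xstar) xstar_lim).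
split => //.
(* The s-part of eta is absorbed into the multiplier, which the x-part has to
   compensate for by its image under the transposed jacobian. *)
exists (x \o phi), (fun k => lsubmx (eta (phi k))
   + rsubmx (eta (phi k)) *m nabla c (x (phi k))),
  (fun k => rsubmx (eta (phi k)) + y (phi k)),
  (fun k => s (phi k) - c (x (phi k))); split => //.
- have -> : 0 = 0 + (0 : 'rV[R]_m) *m nabla c xstar by rewrite mul0mx addr0.
  by apply: cvgD => //; exact: cvg_mulmx.
- by rewrite -(subrr (c xstar)); exact: cvgB.
- move=> k; have [_ sub_q sub_D] := etaP (phi k); split => /=.
    move: sub_q; congr (limiting_subdiff _ _ _).
    by rewrite mulmxDl opprD [RHS]addrC addrA addrK.
  rewrite addrC subrK; exact: limiting_subdiff_indicator.
Qed.
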